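(* (i) Let $x\in\mathcal T^c$. If $\mathcal V(x)=\mathcal V^f(x)$, then $\mathcal U^\rho(x)=\mathcal V(x)$ for any continuous function $\rho:\mathbb R^n\times A\to\mathbb R_+$. (ii) If, for some continuous $\rho:\mathbb R^n\times A\to\mathbb R_+$, $\mathcal U^\rho$ is continuous on $\partial\mathcal T$, then $\mathcal U^\rho\equiv\mathcal V$. Therefore, in particular, if $\mathcal V^f$ is continuous on $\partial\mathcal T$, then $\mathcal V^f\equiv\mathcal U^\rho\equiv\mathcal V$ for any continuous, nonnegative function $\rho$ on $\mathbb R^n\times A$.
   Context: Standing setting. $A\subset\mathbb R^m$ is compact; the target $\mathcal T\subset\mathbb R^n$ is closed with compact boundary; $\mathcal T^c=\mathbb R^n\setminus\mathcal T$, $\overset{\circ}{\mathcal T}$ is the interior of $\mathcal T$, $\mathbb R_+=[0,+\infty[$. The functions $f:\mathbb R^n\times A\to\mathbb R^n$ and $l:\mathbb R^n\times A\to\mathbb R_+$ are continuous; there is $M>0$ with $|f(x,a)|\le M(1+|x|)$ for all $(x,a)$, and for every $R>0$ there is $L_R>0$ with $|f(x_1,a)-f(x_2,a)|\le L_R|x_1-x_2|$ and $|l(x_1,a)-l(x_2,a)|\le L_R|x_1-x_2|$ whenever $|x_1|,|x_2|\le R$, $a\in A$. $\mathcal A$ is the set of measurable controls $\alpha:\mathbb R_+\to A$, and $y_x(\cdot,\alpha)$ is the solution on $\mathbb R_+$ of $\dot y(t)=f(y(t),\alpha(t))$, $y(0)=x$. Put $t_x(\alpha)=\inf\{t\ge0: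 y_x(t,\alpha)\in\mathcal T\}\le+\infty$, $\mathcal J(t,x,\alpha)=\int_0^t l(y_x(s,\alpha),\alpha(s))\,ds$, $\mathcal A(x)=\{\alpha\in\mathcal A:\ \liminf_{t\to t_x(\alpha)^-}\mathrm{dist}(y_x(t,\alpha),\mathcal T)=0\}$, and, for continuous $\rho:\mathbb R^n\times A\to\mathbb R_+$, $\mathcal A_\rho(x)=\{\alpha\in\mathcal A(x):\ \int_0^{t_x(\alpha)}\rho(y_x(t,\alpha),\alpha(t))\,dt<+\infty\}$. For $x\in\mathcal T^c$ (with $\inf\emptyset=+\infty$): $\mathcal V(x)=\inf_{\alpha\in\mathcal A(x)}\mathcal J(t_x(\alpha),x,\alpha)$, $\mathcal V^f(x)=\inf_{\{\alpha\in\mathcal A:\,t_x(\alpha)<+\infty\}}\mathcal J(t_x(\alpha),x,\alpha)$, $\mathcal U^\rho(x)=\inf_{\alpha\in\mathcal A_\rho(x)}\mathcal J(t_x(\alpha),x,\alpha)$. All these functions are $0$ on $\mathcal T$. ''Continuous on $\partial\mathcal T$'' means continuous at each point of $\partial\mathcal T$ as a function on $\mathbb R^n\setminus\overset{\circ}{\mathcal T}$. *)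

(* Defs.v *)
From HB Require Import structures.
From mathcomp Require Import all_boot all_order all_algebra.
From mathcomp Require Import all_classical all_reals all_analysis.
Set Implicit Arguments.
Unset Strict Implicit.
Unset Printing Implicit Defensive.
Import Order.TTheory GRing.Theory Num.Theory.
Import numFieldNormedType.Exports.
Local Open Scope classical_set_scope.
Local Open Scope ring_scope.

(* The library norm on 'rV[R]_n is the sup norm. *)
Definition enorm (R : realType) n (v : 'rV[R]_n) : R :=
  Num.sqrt (\sum_(i < n) v ord0 i ^+ 2).

(* Extended-real valued, so that the distance to the empty set is +oo. *)
Definition edist_set (R : realType) n (T : set 'rV[R]_n) (x : 'rV[R]_n) :
    \bar R :=
  ereal_inf [set (enorm (x - z))%:E | z in T].

Definition bdry (X : topologicalType) (T : set X) : set X :=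
  closure T `\` interior T.

(* Lebesgue (not merely Borel) measurability. *)
Definition lebesgue_measurable (R : realType) (D : set R) : Prop :=
  ((wlength (@idfun R))^*%mu).-cara.-measurable D.

(* A control is a total function of which only the values at times t >= 0
   matter. *)
Definition controls (R : realType) m (A : set 'rV[R]_m) :
    set (R -> 'rV[R]_m) :=
  [set alpha | (forall t, 0 <= t -> A (alpha t)) /\
     (forall U : set 'rV[R]_m, open U ->
        lebesgue_measurable (`[0, +oo[ `&` alpha @^-1` U))].

(* Caratheodory solution on [0, +oo[ of y' = f(y, alpha), y(0) = x. *)
Definition is_trajectory (R : realType) n m
    (f : 'rV[R]_n * 'rV[R]_m -> 'rV[R]_n) (x : 'rV[R]_n)
    (alpha : R -> 'rV[R]_m) (y : R -> 'rV[R]_n) : Prop :=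
  {within `[0, +oo[, continuous y} /\
  forall t, 0 <= t ->
    y t = x + \row_(i < n)
      Rintegral (@completed_lebesgue_measure R) `[0, t]
        (fun s => f (y s, alpha s) ord0 i).

(* Under linear growth and local Lipschitz continuity of f, a trajectory exists
   for every control and is unique on [0, +oo[; the default value of xget is
   then never reached. *)
Definition trajectory (R : realType) n m
    (f : 'rV[R]_n * 'rV[R]_m -> 'rV[R]_n) (x : 'rV[R]_n)
    (alpha : R -> 'rV[R]_m) : R -> 'rV[R]_n :=
  xget (cst x) [set y | is_trajectory f x alpha y].

Definition left_nbhs (R : realType) (t : \bar R) : set_system R :=
  filter_from [set r : R | (r%:E < t)%E]
              (fun r => [set s : R | r < s /\ (s%:E < t)%E]).

Section ControlProblem.
Variables (R : realType) (n m : nat).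
Variables (A : set 'rV[R]_m) (T : set 'rV[R]_n).
Variable f : 'rV[R]_n * 'rV[R]_m -> 'rV[R]_n.
Implicit Types (x : 'rV[R]_n) (alpha : R -> 'rV[R]_m).
Implicit Types l rho : 'rV[R]_n * 'rV[R]_m -> R.

Definition hit_time x alpha : \bar R :=
  ereal_inf [set t%:E | t in [set t : R | 0 <= t /\ T (trajectory f x alpha t)]].

Definition cost l (t : \bar R) x alpha : \bar R :=
  (\int[@completed_lebesgue_measure R]_(s in [set s : R | (0 <= s)%R /\ s%:E <= t])
     (l (trajectory f x alpha s, alpha s))%:E)%E.

Definition adm x : set (R -> 'rV[R]_m) :=
  [set alpha | controls A alpha /\
     limf_einf (fun t : R => edist_set T (trajectory f x alpha t))
               (left_nbhs (hit_time x alpha)) = 0%E].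

Definition adm_fin x : set (R -> 'rV[R]_m) :=
  [set alpha | controls A alpha /\ (hit_time x alpha < +oo)%E].

Definition adm_rho rho x : set (R -> 'rV[R]_m) :=
  [set alpha | adm x alpha /\ (cost rho (hit_time x alpha) x alpha < +oo)%E].

Definition value_over (S : 'rV[R]_n -> set (R -> 'rV[R]_m)) l x : \bar R :=
  if x \in T then 0%E
  else ereal_inf [set cost l (hit_time x alpha) x alpha | alpha in S x].

Definition value := value_over adm.
Definition value_fin := value_over adm_fin.
Definition value_rho rho := value_over (adm_rho rho).

Definition continuous_nonneg rho : Prop :=
  {within [set z : 'rV[R]_n * 'rV[R]_m | A z.2], continuous rho} /\
  forall x a, A a -> 0 <= rho (x, a).

Definition continuous_on_bdry (W : 'rV[R]_n -> \bar R) : Prop :=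
  forall x, bdry T x -> W @ within (~` interior T) (nbhs x) --> W x.

End ControlProblem.

(* Main.v *)
(* The only gap between [value] and the other two value functions comes from controls whose
   path approaches the target without ever hitting it: hitting in finite time keeps the cost of
   a continuous running cost finite. Let such a path start at [x]. At suitable times it is
   outside [T] and arbitrarily close to [T], hence arbitrarily close to the compact boundary.
   If the value function is continuous on the boundary, where it vanishes, it is then less than
   [e] at the current point. Switching there to an [e]-optimal control gives an admissible
   control for [x] whose cost exceeds that of the original one by at most [e]. That the path of
   the spliced control is the splice of the two paths follows from uniqueness of trajectories
   and translation invariance of Lebesgue measure. Existence of trajectories is never used:
   without one, the default path is constant, so the control is not admissible off [T]. *)
Require Import Defs.
From mathcomp Require Import all_boot all_order all_algebra.
From mathcomp Require Import all_classical all_reals all_analysis.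
From mathcomp Require Import measurable_realfun.
From mathcomp Require Import ring lra.
Set Implicit Arguments.
Unset Strict Implicit.
Unset Printing Implicit Defensive.
Import Order.TTheory GRing.Theory Num.Theory.
Import numFieldNormedType.Exports.
Local Open Scope classical_set_scope.
Local Open Scope ring_scope.

(** * Translation invariance of the completed Lebesgue measure *)

(* The real line with the Lebesgue sigma-algebra. *)
Local Notation lebR R := (caratheodory_type ((wlength (@idfun R))^*)%mu).
Local Notation leb := (@completed_lebesgue_measure _).

Section MeasurePreserving.
Context d (T : measurableType d) (R : realType).
Variables (mu : {measure set T -> \bar R}) (phi : T -> T).
Hypothesis mphi : measurable_fun setT phi.
Hypothesis mu_phi : forall B, measurable B -> mu (phi @^-1` B) = mu B.

(** The pushforward of [mu] under [phi] coincides with [mu] on measurable sets, so this is the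
    change of variables formula for the pushforward. *)
Lemma ge0_integral_measure_preserving (D : set T) (g : T -> \bar R) :
  measurable D -> measurable_fun D g -> {in D, forall y, 0 <= g y}%E ->
  (\int[mu]_(s in D) g s = \int[mu]_(s in phi @^-1` D) g (phi s))%E.
Proof.
move=> mD mg g0; rewrite -(ge0_integral_pushforward mphi _ mD)//.
by apply: eq_measure_integral => B mB _; exact: esym (mu_phi mB).
Qed.

Lemma Rintegral_measure_preserving (D : set T) (g : T -> R) :
  measurable D -> measurable_fun D g ->
  \int[mu]_(s in D) g s = \int[mu]_(s in phi @^-1` D) g (phi s).
Proof.
move=> mD mg; have {}mg : measurable_fun D (EFin \o g) by exact/measurable_EFinP.
rewrite /Rintegral; congr fine; rewrite integralE [RHS]integralE; congr (_ - _)%E.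
  rewrite (ge0_integral_measure_preserving mD (measurable_funepos mg))//.
  by apply: eq_integral => s _; rewrite !funeposE.
rewrite (ge0_integral_measure_preserving mD (measurable_funeneg mg))//.
  by apply: eq_integral => s _; rewrite !funenegE.
Qed.

End MeasurePreserving.

Section Translation.
Context {R : realType}.
Implicit Types (c : R) (X D : set R).

(** Lebesgue outer measure is an infimum over countable covers by intervals []a, b]]. Translating a
    cover of [X] gives a cover of the translated set with the same lengths. The argument applies to
    arbitrary sets, as the Caratheodory criterion requires. *)
Lemma leb_shift_le c X : (leb ((fun s => (s + c)%R) @^-1` X) <= leb X)%E.
Proof.
apply: ereal_inf_le_tmp => _ [F [mF XF] <-].
exists (fun i => (fun s => s + c) @^-1` F i).
  split; last by move=> s /XF [i _ Fi]; exists i.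
  move=> i; have [[a b] _ <-] := mF i; exists (a - c, b - c) => //=.
  by apply/seteqP; split => s /=; rewrite !in_itv/= ltrBlDr lerBrDr.
apply: congr_lim; apply/funext => k; apply: eq_bigr => i _.
have [[a b] _ <-] := mF i.
rewrite (_ : _ @^-1` _ = [set` `](a - c), (b - c)]]); last first.
  by apply/seteqP; split => s /=; rewrite !in_itv/= ltrBlDr lerBrDr.
rewrite [LHS](wlength_itv idfun `](a - c), (b - c)]).
rewrite [RHS](wlength_itv idfun `]a, b])/= !lte_fin ltrD2r; case: ifP => //= _.
by rewrite -!EFinB opprB addrA subrK.
Qed.

Lemma leb_shift c X : leb ((fun s => (s + c)%R) @^-1` X) = leb X.
Proof.
apply/eqP; rewrite eq_le leb_shift_le/=.
rewrite [X in (leb X <= _)%E](_ : _ = (fun s => s + - c) @^-1`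
   ((fun s => s + c) @^-1` X)) ?leb_shift_le//.
by apply/funext => s /=; rewrite subrK.
Qed.

(** Testing the translate against [Y] amounts to testing [X] against [Y] translated back, because
    outer measure is translation invariant on all sets. *)
Lemma lebesgue_measurable_shift c X :
  lebesgue_measurable X -> lebesgue_measurable ((fun s => s + c) @^-1` X).
Proof.
move=> mX.
have {}mX : forall Y, leb Y = (leb (Y `&` X) + leb (Y `&` ~` X))%E := mX.
suff mX' : forall Y, leb Y = (leb (Y `&` (fun s => (s + c)%R) @^-1` X) +
    leb (Y `&` ~` ((fun s => (s + c)%R) @^-1` X)))%E by exact: mX'.
move=> Y; have YE : (fun s => s + c) @^-1` ((fun s => s - c) @^-1` Y) = Y.
  by apply/funext => s /=; rewrite addrK.
transitivity (leb ((fun s => s - c) @^-1` Y)); first by rewrite (leb_shift (- c) Y).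
rewrite (mX ((fun s => s - c) @^-1` Y)); congr (_ + _)%E.
  by rewrite -(leb_shift c (_ `&` X)); congr (leb _); rewrite -[in RHS]YE.
rewrite -(leb_shift c (_ `&` ~` X)); congr (leb _); rewrite -[in RHS]YE.
by [].
Qed.

Lemma measurable_fun_shift c :
  measurable_fun setT (fun s : lebR R => (s + c)%R : lebR R).
Proof.
by move=> _ B mB; rewrite setTI; exact: lebesgue_measurable_shift.
Qed.

Lemma borel_lebesgue_measurable (D : set R) :
  measurable D -> lebesgue_measurable D.
Proof. exact: sub_caratheodory. Qed.

Lemma lebesgue_measurable_itv (i : interval R) : lebesgue_measurable [set` i].
Proof. by apply: borel_lebesgue_measurable; exact: measurable_itv. Qed.

Lemma leb_itv (a b : R) : a <= b -> leb `[a, b] = (b - a)%:E.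
Proof.
move=> ab; transitivity (lebesgue_measure `[a, b]) => //.
rewrite lebesgue_measure_itv/= lte_fin lt_neqAle ab andbT.
by case: eqVneq => [->|]; rewrite ?subrr// EFinB.
Qed.

Lemma leb_set1 (a : R) : leb [set a] = 0%E.
Proof. by rewrite -set_itv1 leb_itv// subrr. Qed.

Lemma ge0_integral_shift c (D : set (lebR R)) (g : lebR R -> \bar R) :
  measurable D -> measurable_fun D g -> {in D, forall y, 0 <= g y}%E ->
  (\int[leb]_(s in D) g s =
   \int[leb]_(s in (fun s => (s + c)%R) @^-1` D) g (s + c)%R)%E.
Proof.
apply: (@ge0_integral_measure_preserving _ (lebR R) R
  (@completed_lebesgue_measure R) _ (measurable_fun_shift c)) => B _.
exact: leb_shift.
Qed.

Lemma Rintegral_shift c (D : set (lebR R)) (g : lebR R -> R) :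
  measurable D -> measurable_fun D g ->
  Rintegral leb D g =
  Rintegral leb ((fun s => (s + c)%R) @^-1` D) (fun s => g (s + c)%R).
Proof.
apply: (@Rintegral_measure_preserving _ (lebR R) R
  (@completed_lebesgue_measure R) _ (measurable_fun_shift c)) => B _.
exact: leb_shift.
Qed.

End Translation.

(** * Measurability of running costs along a path *)

Section Running.
Context {R : realType} {n m : nat}.
Implicit Types (A : set 'rV[R]_m) (y : R -> 'rV[R]_n) (alpha : R -> 'rV[R]_m).
Implicit Types (g : 'rV[R]_n * 'rV[R]_m -> R).

Lemma cvg_within_range (I : Type) (F : set_system I) (X : topologicalType)
    (S : set X) (u : I -> X) (z : X) : Filter F ->
  (forall k, S (u k)) -> u @ F --> z -> u @ F --> within S (nbhs z).
Proof.
move=> FF Su uz P zP; have FP : F [set k | S (u k) -> P (u k)] := uz _ zP.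
by rewrite nbhs_filterE; apply: (@filterS _ F _ _ _ _ FP) => k /(_ (Su k)).
Qed.

Lemma cvg_pair_nbhs (I : Type) (F : set_system I) (X Y : topologicalType)
    (u : I -> X) (v : I -> Y) (x : X) (y : Y) : Filter F ->
  u @ F --> x -> v @ F --> y -> (u i, v i) @[i --> F] --> (x, y).
Proof. by move=> FF ux vy; exact: (cvg_pair ux vy). Qed.

Lemma measurable_frozen A alpha g (c : 'rV[R]_n) : controls A alpha ->
  {within [set z | A z.2], continuous g} ->
  measurable_fun (`[0, +oo[ : set (lebR R)) (fun s => g (c, alpha s)).
Proof.
move=> [alphaA malpha] cg mD.
apply: (measurability _ (RGenOInfty.measurableE R)) => // _ [_ [r ->] <-].
have [W oW WE] : exists2 W, open W &
    W `&` [set z | A z.2] = (g @^-1` `]r, +oo[) `&` [set z | A z.2].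
  apply/open_subspaceP; apply: (@open_comp _ _ (g : subspace _ -> R)) => //.
have /malpha mW : open [set a | W (c, a)].
  apply: (@open_comp _ _ (fun a => (c, a))) => // a _.
  exact: (@cvg_pair_nbhs _ (nbhs a) _ _ (cst c) id c a _ (cvg_cst _) cvg_id).
rewrite (_ : _ `&` _ = `[0, +oo[ `&` alpha @^-1` [set a | W (c, a)]);
  first exact: mW.
apply/seteqP; split => s /= [s0 P]; split => //;
  have As : A (alpha s) by apply: alphaA; move: s0; rewrite in_itv/= andbT.
- have [] // : (W `&` [set z | A z.2]) (c, alpha s) by rewrite WE.
- have [] // : (g @^-1` `]r, +oo[ `&` [set z | A z.2]) (c, alpha s) by rewrite -WE.
Qed.

Let grid (k : nat) (s : R) : R := (Num.truncn (s * k.+1%:R))%:R / k.+1%:R.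

Let cvg_grid (s : R) : 0 <= s -> grid ^~ s @ \oo --> s.
Proof.
move=> s0; apply/cvgrPdist_lt => e e0; near=> k.
have k0 : 0 < k.+1%:R :> R by [].
have /truncn_itv/andP[l u] : 0 <= s * k.+1%:R by rewrite mulr_ge0.
rewrite ger0_norm ?subr_ge0 ?ler_pdivrMr//.
apply: (@le_lt_trans _ _ k.+1%:R^-1); last first.
  by near: k; exact: near_infty_natSinv_lt (PosNum e0).
rewrite lerBlDr -[X in X + _]mul1r -mulrDl ler_pdivlMr// addrC natr1.
exact: ltW.
Unshelve. all: by end_near. Qed.

(** Sampling the path at multiples of [1 / (k + 1)] freezes the state on each of countably many
    intervals, where [measurable_frozen] applies. By continuity of [y] and [g] the sampled functions
    converge pointwise to the running cost. *)
Lemma measurable_running A alpha y g : controls A alpha ->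
  {within `[0, +oo[, continuous y} ->
  {within [set z | A z.2], continuous g} ->
  measurable_fun (`[0, +oo[ : set (lebR R)) (fun s => g (y s, alpha s)).
Proof.
move=> calpha cy cg.
apply: (@measurable_fun_cvg _ (lebR R) R _ (fun k s => g (y (grid k s), alpha s))).
  move=> k mD B mB.
  rewrite (_ : _ `&` _ = \bigcup_j
     ((`[0, +oo[ `&` (fun s => g (y (j%:R / k.+1%:R), alpha s)) @^-1` B) `&`
      `[j%:R / k.+1%:R, j.+1%:R / k.+1%:R[)).
    apply: bigcupT_measurable => j; apply: measurableI.
      exact: (measurable_frozen _ calpha cg).
    exact: lebesgue_measurable_itv.
  apply/seteqP; split => s /=.
    move=> [s0 Bs]; exists (Num.truncn (s * k.+1%:R)) => //; split => //.
    rewrite /= in_itv/= ler_pdivrMr// ltr_pdivlMr//.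
    by apply: truncn_itv; rewrite mulr_ge0//; move: s0; rewrite in_itv/= andbT.
  move=> [j _ [[s0 Bs]]]; rewrite /= in_itv/= ler_pdivrMr// ltr_pdivlMr// => js.
  by split => //; rewrite /grid (truncn_def js).
move=> s; rewrite /= in_itv/= andbT => s0.
have As : A (alpha s) by apply: calpha.1.
have cyk : y (grid k s) @[k --> \oo] --> y s.
  move/subspace_continuousP : cy => /(_ s); rewrite /= in_itv/= andbT => /(_ s0).
  apply: cvg_comp; apply: cvg_within_range; last exact: cvg_grid.
  by move=> k; rewrite /= in_itv/= andbT divr_ge0.
move/subspace_continuousP : cg => /(_ (y s, alpha s) As).
apply: cvg_comp; apply: cvg_within_range => //.
by apply: cvg_pair_nbhs => //; exact: cvg_cst.
Qed.

End Running.

(** * Comparison of the Euclidean norm with the sup norm *)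

Section EuclideanNorm.
Context {R : realType} {n : nat}.
Implicit Types v w : 'rV[R]_n.

Lemma enorm_ge0 v : 0 <= enorm v.
Proof. exact: sqrtr_ge0. Qed.

Lemma coord_le_enorm v i : `|v ord0 i| <= enorm v.
Proof.
rewrite -sqrtr_sqr /enorm ler_sqrt ?sumr_ge0//; last by move=> j _; exact: sqr_ge0.
by rewrite (bigD1 i)//= lerDl sumr_ge0// => j _; exact: sqr_ge0.
Qed.

Lemma enorm_le v (B : R) : (forall i, `|v ord0 i| <= B) -> enorm v <= n%:R * B.
Proof.
(* In dimension 0 the hypothesis says nothing about the sign of [B], so that case is separate.
   Otherwise [B >= 0], and [(k + 1) B^2 <= ((k + 1) B)^2] gives the crude factor. *)
case: n v => [v _|k v vB]; first by rewrite /enorm big_ord0 sqrtr0 mul0r.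
have B0 : 0 <= B by exact: le_trans (vB ord0).
have kB0 : 0 <= k.+1%:R * B by exact: mulr_ge0.
rewrite -[leRHS]ger0_norm// -sqrtr_sqr ler_wsqrtr// exprMn.
apply: (@le_trans _ _ (\sum_(i < k.+1) B ^+ 2)).
  by apply: ler_sum => i _; rewrite -real_normK ?num_real// lerXn2r ?nnegrE.
rewrite sumr_const card_ord -[leLHS]mulr_natl ler_wpM2r ?sqr_ge0//.
by rewrite -natrX ler_nat -{1}(expn1 k.+1) leq_pexp2l.
Qed.

Lemma enorm_le_norm v : enorm v <= n%:R * `|v|.
Proof.
apply: enorm_le => i; rewrite (_ : `|v| = mx_norm v)// mx_normrE.
by apply/bigmax_geP; right; exists (ord0, i).
Qed.

Lemma norm_le_enorm v : `|v| <= enorm v.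
Proof.
rewrite (_ : `|v| = mx_norm v)// mx_normrE; apply: bigmax_le => [|[i j] _].
  exact: enorm_ge0.
by rewrite ord1; exact: coord_le_enorm.
Qed.

Lemma enorm_distC v w : enorm (v - w) = enorm (w - v).
Proof. by congr Num.sqrt; apply: eq_bigr => i _; rewrite -opprB mxE sqrrN. Qed.

End EuclideanNorm.

(** * Bounds and splitting of real-valued integrals *)

Section RintegralBounds.
Context d (T : measurableType d) (R : realType) (mu : {measure set T -> \bar R}).

Lemma Rintegral_bound (D : set T) (g : T -> R) (B : R) :
  measurable D -> (mu D < +oo)%E -> mu.-integrable D (EFin \o g) ->
  (forall s, D s -> `|g s| <= B) -> `|Rintegral mu D g| <= B * fine (mu D).
Proof.
move=> mD Dfin ig gB; rewrite -Rintegral_cst//.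
apply: le_trans (le_normr_Rintegral mD ig) _.
apply: le_Rintegral => //; first exact: integrable_norm.
apply: measurable_bounded_integrable => //.
by exists `|B|; split => // M BM s _; rewrite /= ltW.
Qed.

Lemma Rintegral_null_set (N : set T) (g : T -> R) :
  measurable N -> measurable_fun N g -> mu N = 0%E -> Rintegral mu N g = 0.
Proof.
move=> mN /measurable_EFinP mg N0.
by rewrite /Rintegral null_set_integral.
Qed.

End RintegralBounds.

Section Splitting.
Context {R : realType}.
Implicit Types (a t B : R) (g : lebR R -> R).

Lemma Rintegral_split a t g : 0 <= a -> a <= t ->
  leb.-integrable `[0, t] (EFin \o g) ->
  Rintegral leb `[0, t] g = Rintegral leb `[0, a] g + Rintegral leb `]a, t] g.
Proof.
move=> a0 at_ ig.
have E : (`[0, t] = `[0, a] `|` `]a, t])%classic.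
  by rewrite -itv_bndbnd_setU// bnd_simp.
rewrite E Rintegral_setU//.
- exact: lebesgue_measurable_itv.
- exact: lebesgue_measurable_itv.
- by rewrite -E.
- rewrite disj_set2E; apply/eqP/seteqP; split => // s [] /=.
  by rewrite !in_itv/= => /andP[_ sa] /andP[]; rewrite ltNge sa.
Qed.

Lemma Rintegral_set1 a g : Rintegral leb [set a] g = 0.
Proof.
apply: Rintegral_null_set; last exact: leb_set1.
  by rewrite -set_itv1; exact: lebesgue_measurable_itv.
exact: measurable_fun_set1.
Qed.

Lemma Rintegral_open_left t g : 0 <= t ->
  leb.-integrable `[0, t] (EFin \o g) ->
  Rintegral leb `]0, t] g = Rintegral leb `[0, t] g.
Proof.
move=> t0 ig; rewrite [RHS](@Rintegral_split 0)// set_itv1.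
by rewrite Rintegral_set1 add0r.
Qed.

Lemma Rintegral_bound_tail a t B g : 0 <= a -> a <= t ->
  leb.-integrable `[0, t] (EFin \o g) ->
  (forall s, 0 <= s <= a -> g s = 0) ->
  (forall s, a < s <= t -> `|g s| <= B) ->
  `|Rintegral leb `[0, t] g| <= B * (t - a).
Proof.
move=> a0 at_ ig g0 gB; rewrite (@Rintegral_split a)//.
have -> : Rintegral leb `[0, a] g = 0.
  transitivity (Rintegral leb `[0, a] (cst (0 : R))).
    by apply: eq_Rintegral => s; rewrite inE/= in_itv/= => /g0.
  by rewrite Rintegral_cst ?mul0r//; exact: lebesgue_measurable_itv.
have sub : `]a, t] `<=` `[0, t].
  by move=> s; rewrite /= !in_itv/= => /andP[/ltW/(le_trans a0) -> ->].
have mat : measurable (`]a, t]%classic : set (lebR R)) by exact: lebesgue_measurable_itv.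
have E : leb `]a, t] = (t - a)%:E.
  transitivity (lebesgue_measure `]a, t]) => //.
  rewrite lebesgue_measure_itv/= lte_fin lt_neqAle at_ andbT.
  by case: eqVneq => [->|]; rewrite ?subrr// EFinB.
rewrite add0r.
have -> : t - a = fine (leb `]a, t]) by rewrite E.
have Ef : (leb `]a, t] < +oo)%E by rewrite E ltry.
apply: (Rintegral_bound mat Ef); last by move=> s; rewrite /= in_itv/=; exact: gB.
by apply: integrableS ig => //; exact: lebesgue_measurable_itv.
Qed.

End Splitting.

(** * Uniqueness of trajectories *)

(** One polymorphic splice serves controls, paths and running costs alike. *)
Definition concat (R : realType) (X : Type) (tau : R) (u v : R -> X) : R -> X :=
  fun s => if s <= tau then u s else v (s - tau).

Section Trajectories.
Context {R : realType} {n m : nat}.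
Variables (A : set 'rV[R]_m) (f : 'rV[R]_n * 'rV[R]_m -> 'rV[R]_n).
Hypothesis A_compact : compact A.
Hypothesis f_cont : {within [set z | A z.2], continuous f}.
Hypothesis f_lip : forall r : R, 0 < r -> exists2 L : R, 0 < L &
  forall x1 x2 a, enorm x1 <= r -> enorm x2 <= r -> A a ->
    enorm (f (x1, a) - f (x2, a)) <= L * enorm (x1 - x2).
Implicit Types (x : 'rV[R]_n) (y : R -> 'rV[R]_n) (alpha beta : R -> 'rV[R]_m).
Implicit Types (g : 'rV[R]_n * 'rV[R]_m -> R) (t tau : R).

Lemma compact_path y t : {within `[0, +oo[, continuous y} -> compact (y @` `[0, t]).
Proof.
move=> cy; apply: continuous_compact; last exact: segment_compact.
by apply: continuous_subspaceW cy => s; rewrite /= !in_itv/= andbT => /andP[].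
Qed.

Lemma bounded_running alpha y g t : controls A alpha ->
  {within `[0, +oo[, continuous y} ->
  {within [set z | A z.2], continuous g} ->
  exists K : R, forall s, 0 <= s <= t -> `|g (y s, alpha s)| <= K.
Proof.
move=> [alphaA _] cy cg.
have : compact (g @` ((y @` `[0, t]) `*` A)).
  apply: continuous_compact; last by apply: compact_setX A_compact; exact: compact_path.
  by apply: continuous_subspaceW cg => z [].
move=> /compact_bounded[K [_ /(_ (K + 1))]]; rewrite ltrDl => /(_ ltr01) gK.
exists (K + 1) => s st; apply: gK => /=; exists (y s, alpha s) => //; split => /=.
  by exists s => //; rewrite in_itv.
by apply: alphaA; case/andP: st.
Qed.

Lemma measurable_running_itv alpha y g (D : set (lebR R)) : controls A alpha ->
  {within `[0, +oo[, continuous y} ->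
  {within [set z | A z.2], continuous g} ->
  D `<=` `[0, +oo[ -> measurable_fun D (fun s => g (y s, alpha s)).
Proof.
move=> ca cy cg D0; apply: measurable_funS D0 (measurable_running ca cy cg).
exact: lebesgue_measurable_itv.
Qed.

Lemma integrable_running alpha y g t : controls A alpha ->
  {within `[0, +oo[, continuous y} ->
  {within [set z | A z.2], continuous g} ->
  leb.-integrable `[0, t] (EFin \o (fun s => g (y s, alpha s))).
Proof.
move=> ca cy cg; have [t0|t0] := leP 0 t; last first.
  by rewrite set_itv_ge ?bnd_simp -?ltNge//; exact: integrable_set0.
have mt : measurable (`[0, t]%classic : set (lebR R)) by exact: lebesgue_measurable_itv.
have ft : (leb (`[0%R, t]%classic : set R) < +oo)%E by rewrite leb_itv// ltry.
apply: (measurable_bounded_integrable mt ft).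
  by apply: measurable_running_itv cg _ => // s; rewrite /= !in_itv/= andbT => /andP[].
have [K gK] := bounded_running t ca cy cg.
exists K; split; first exact: num_real.
by move=> M KM s; rewrite /= in_itv/= => /gK /le_trans; apply; exact: ltW.
Qed.

Lemma coord_f_cont i : {within [set z | A z.2], continuous (fun z => f z ord0 i)}.
Proof.
move=> z; apply: (@continuous_comp _ _ _ (f : subspace _ -> _) (fun v => v ord0 i)).
  exact: f_cont.
exact: coord_continuous.
Qed.

Lemma path_bounded y t : {within `[0, +oo[, continuous y} ->
  exists2 r, 0 < r & forall s, 0 <= s <= t -> enorm (y s) <= r.
Proof.
move=> /(@compact_path _ t)/compact_bounded[K [_ /(_ (`|K| + 1))]].
rewrite ltr_pwDr ?ler_norm// => /(_ isT) yK.
(* The factor [n.+1] dominates the norm comparison constant [n] and keeps the radius positive in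
   dimension 0. *)
exists (n.+1%:R * (`|K| + 1)) => [|s st].
  by rewrite mulr_gt0// ltr_wpDl.
apply: le_trans (enorm_le_norm _) _; apply: ler_pM => //; first by rewrite ler_nat.
by apply: yK; exists s => //; rewrite /= in_itv.
Qed.

Lemma is_trajectory_coord x alpha y t i : is_trajectory f x alpha y -> 0 <= t ->
  y t ord0 i = x ord0 i + Rintegral leb `[0, t] (fun s => f (y s, alpha s) ord0 i).
Proof. by move=> [_ ytr] t0; rewrite [in LHS](ytr _ t0) !mxE. Qed.

(* On a window of length at most [1 / (2 (n + 1) L)] the integral equation halves any bound on
   the distance of two solutions that agree before the window. *)
Lemma is_trajectory_unique x alpha y1 y2 t : controls A alpha ->
  is_trajectory f x alpha y1 -> is_trajectory f x alpha y2 ->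
  0 <= t -> y1 t = y2 t.
Proof.
move=> ca tr1 tr2 t0; have [cy1 _] := tr1; have [cy2 _] := tr2.
have [r1 r10 y1r] := path_bounded t cy1.
have [r2 r20 y2r] := path_bounded t cy2.
pose r := Num.max r1 r2.
have r0 : 0 < r by rewrite lt_max r10.
have [L L0 fL] := f_lip r0.
pose N : R := n.+1%:R.
have N0 : 0 < N by rewrite /N.
have NL0 : 0 < 2 * N * L by rewrite !mulr_gt0.
pose h := (2 * N * L)^-1.
have h0 : 0 < h by rewrite invr_gt0.
(* Repeated halving forces a vector to vanish; [j < 2 ^ j] supplies an exponent for every precision
   [e]. *)
have eq0 (v : 'rV[R]_n) (C : R) : (forall j, enorm v <= C / 2 ^+ j) -> v = 0.
  move=> vC; apply/rowP => i; rewrite mxE; apply/eqP; rewrite -normr_eq0 eq_le normr_ge0 andbT.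
  apply: le_trans (coord_le_enorm _ _) _.
  apply/ler_addgt0Pr => e e0; rewrite add0r.
  have [j Cj] : exists j : nat, C / e < 2 ^+ j.
    exists (Num.truncn (C / e)).+1; apply: lt_trans (truncnS_gt _) _.
    by rewrite -natrX ltr_nat ltn_expl.
  apply: le_trans (vC j) _; rewrite ler_pdivrMr ?exprn_gt0// mulrC -ler_pdivrMr//.
  exact: ltW.
(* Outer induction: agreement on [[0, k h]] is extended by one window at a time, and finitely many
   windows cover [[0, t]]. *)
suff eqk (k : nat) : forall s, 0 <= s <= t -> s <= k%:R * h -> y1 s = y2 s.
  apply: (eqk (Num.truncn (t / h)).+1); first by rewrite t0 lexx.
  by rewrite -ler_pdivrMr// ltW// truncnS_gt.
elim: k => [s /andP[s0 _]|k IH s st sk].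
  rewrite mul0r => s1; have -> : s = 0 by apply/eqP; rewrite eq_le s1.
  by apply/rowP => i; rewrite (is_trajectory_coord i tr1)// (is_trajectory_coord i tr2)//
    !set_itv1 !Rintegral_set1.
(* Inner induction on the number [j] of halvings. It starts from the bound given by both paths
   staying in the ball of radius [r], and it keeps [s] general because the bound is used under the
   integral. *)
apply/eqP; rewrite -subr_eq0; apply/eqP/(eq0 _ (N * (r + r))) => j.
elim: j s st sk => [|j IHj] s st sk.
  rewrite expr0 divr1; apply: le_trans (@enorm_le _ _ _ (r + r) _) _; last first.
    by rewrite ler_pM2r ?addr_gt0// ler_nat.
  move=> i; rewrite !mxE; apply: le_trans (ler_normB _ _) _; apply: lerD.
    by apply: le_trans (coord_le_enorm _ _) _; rewrite (le_trans (y1r _ st))// le_max lexx.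
  by apply: le_trans (coord_le_enorm _ _) _; rewrite (le_trans (y2r _ st))// le_max lexx orbT.
have [sk'|sk'] := leP s (k%:R * h).
  rewrite (IH _ st sk') subrr; apply: le_trans (enorm_le_norm _) _.
  by rewrite normr0 mulr0 divr_ge0// ?mulr_ge0 ?addr_ge0 ?exprn_ge0 ?ltW.
set B := N * (r + r) / 2 ^+ j in IHj *.
have B0 : 0 <= B by rewrite divr_ge0// ?mulr_ge0 ?addr_ge0 ?exprn_ge0 ?ltW.
have s0 : 0 <= s by case/andP: st.
(* The choice of [h] gives [N * L * h = 1 / 2], so this coordinate bound yields [B / 2] for the
   Euclidean norm. *)
suff coordB i : `|(y1 s - y2 s) ord0 i| <= L * B * h.
  apply: le_trans (enorm_le coordB) _.
  apply: (@le_trans _ _ (N * (L * B * h))).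
    apply: ler_wpM2r; last by rewrite /N ler_nat.
    exact: mulr_ge0 (mulr_ge0 (ltW L0) B0) (ltW h0).
  have -> : N * (r + r) / 2 ^+ j.+1 = B / 2 by rewrite /B exprS; field; rewrite expf_neq0.
  have -> : N * (L * B * h) = B / 2; last by [].
  by rewrite /h; move: (gt_eqF N0) (gt_eqF L0); clearbody N B => N1 L1; field; rewrite N1 L1.
rewrite !mxE (is_trajectory_coord i tr1)// (is_trajectory_coord i tr2)//.
rewrite opprD addrACA subrr add0r -RintegralB//; last 3 first.
- exact: lebesgue_measurable_itv.
- exact: (integrable_running _ ca cy1 (@coord_f_cont i)).
- exact: (integrable_running _ ca cy2 (@coord_f_cont i)).
have kh0 : 0 <= k%:R * h by rewrite mulr_ge0// ltW.
apply: (@le_trans _ _ (L * B * (s - k%:R * h))); last first.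
  apply: ler_wpM2l; first exact: mulr_ge0 (ltW L0) B0.
  by rewrite lerBlDl -[X in _ + X]mul1r -mulrDl natr1.
have sst u : 0 <= u <= s -> 0 <= u <= t.
  by move=> /andP[-> /le_trans]; apply; case/andP: st.
(* The outer induction makes the integrand vanish up to [k h]; on the rest the inner one and the
   Lipschitz condition bound it by [L * B]. *)
apply: (@Rintegral_bound_tail _ _ _ _
  (fun u => f (y1 u, alpha u) ord0 i - f (y2 u, alpha u) ord0 i)) => //.
- exact: ltW.
- rewrite (_ : _ \o _ = (EFin \o (fun u => f (y1 u, alpha u) ord0 i)) \-
    (EFin \o (fun u => f (y2 u, alpha u) ord0 i)))%E//.
  apply: integrableB; first exact: lebesgue_measurable_itv.
  + exact: (integrable_running _ ca cy1 (@coord_f_cont i)).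
  + exact: (integrable_running _ ca cy2 (@coord_f_cont i)).
- move=> u /andP[u0 uk]; rewrite (IH u) ?subrr//.
  by apply: sst; rewrite u0 (le_trans uk)// ltW.
- move=> u /andP[ku us].
  have u0 : 0 <= u by exact: le_trans (ltW ku).
  have ut : 0 <= u <= t by apply: sst; rewrite u0.
  have := coord_le_enorm (f (y1 u, alpha u) - f (y2 u, alpha u)) i.
  rewrite !mxE => /le_trans; apply.
  apply: le_trans (fL _ _ _ _ _ _) _.
  + by rewrite (le_trans (y1r _ ut))// le_max lexx.
  + by rewrite (le_trans (y2r _ ut))// le_max lexx orbT.
  + exact: ca.1.
  + by rewrite ler_pM2l//; apply: IHj => //; exact: le_trans sk.
Qed.

End Trajectories.

(** * Splicing controls and paths *)

Section Concat.
Context {R : realType}.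
Implicit Types (tau t : R).

Lemma concat_le (X : Type) tau (u v : R -> X) t : t <= tau -> concat tau u v t = u t.
Proof. by rewrite /concat => ->. Qed.

Lemma concat_gt (X : Type) tau (u v : R -> X) t :
  tau < t -> concat tau u v t = v (t - tau).
Proof. by rewrite /concat leNgt => ->. Qed.

(** Both formulas are continuous on closed pieces that cover the half-line, and they agree at the
    junction since [u tau = v 0]. *)
Lemma concat_continuous (X : topologicalType) tau (u v : R -> X) : 0 <= tau ->
  {within `[0, +oo[, continuous u} -> {within `[0, +oo[, continuous v} ->
  u tau = v 0 -> {within `[0, +oo[, continuous (concat tau u v)}.
Proof.
move=> tau0 cu cv uv.
have -> : (`[0, +oo[ = `[0, tau] `|` `[tau, +oo[)%classic.
  apply/seteqP; split => s /=; rewrite !in_itv/= !andbT.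
    by move=> s0; have [st|/ltW st] := leP s tau; [left; rewrite s0|right].
  by move=> [/andP[]//|]; exact: le_trans.
apply: withinU_continuous; [exact: interval_closed|exact: interval_closed| |].
- apply: (@subspace_eq_continuous _ _ _ (u : subspace `[0, tau] -> X)).
    by move=> s; rewrite inE/= in_itv/= => /andP[_ st]; exact/esym/concat_le.
  by apply: continuous_subspaceW cu => s; rewrite /= !in_itv/= andbT => /andP[].
- apply: (@subspace_eq_continuous _ _ _ ((fun s => v (s - tau)) : subspace `[tau, +oo[ -> X)).
    move=> s; rewrite inE/= in_itv/= andbT le_eqVlt => /predU1P[<-|ts].
      by rewrite [RHS](concat_le u v (lexx tau)) subrr.
    exact/esym/concat_gt.
  apply/subspace_continuousP => s; rewrite /= in_itv/= andbT => ts.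
  move/subspace_continuousP : cv => /(_ (s - tau)).
  rewrite /= in_itv/= andbT subr_ge0 => /(_ ts); apply: cvg_comp.
  move=> P; rewrite !nbhs_filterE /within/= => HP.
  have : (fun r : R => r - tau) @ s --> s - tau.
    by apply: cvgB; [exact: cvg_id|exact: cvg_cst].
  move=> /(_ _ HP); rewrite !nbhs_filterE/=; apply: filterS => r /= Pr rt.
  by apply: Pr; move: rt; rewrite !in_itv/= !andbT subr_ge0.
Qed.

Lemma controls_concat m (A : set 'rV[R]_m) tau (alpha beta : R -> 'rV[R]_m) :
  0 <= tau -> controls A alpha -> controls A beta -> controls A (concat tau alpha beta).
Proof.
move=> tau0 [Aa ma] [Ab mb]; split => [t t0|U oU].
  rewrite /concat; case: ifPn => [_|]; first exact: Aa.
  by rewrite -ltNge => tt; apply: Ab; rewrite subr_ge0 ltW.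
rewrite (_ : _ `&` _ = (`[0, tau] `&` (`[0, +oo[ `&` alpha @^-1` U)) `|`
   (`]tau, +oo[ `&` (fun s => s - tau) @^-1` (`[0, +oo[ `&` beta @^-1` U))).
  apply: (@measurableU _ (lebR R)); apply: (@measurableI _ (lebR R)).
  - exact: lebesgue_measurable_itv.
  - exact: ma.
  - exact: lebesgue_measurable_itv.
  - by apply: lebesgue_measurable_shift; exact: mb.
apply/seteqP; split => s /=; rewrite !in_itv/= !andbT.
- move=> [s0]; rewrite /concat; case: ifPn => [st aU|]; [left|rewrite -ltNge => ts bU; right].
    by rewrite s0 ?st.
  by rewrite ts subr_ge0 ltW.
- move=> [[/andP[s0 st] [_ aU]]|[ts [_ bU]]]; first by rewrite concat_le.
  by rewrite concat_gt// (le_trans tau0)// ltW.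
Qed.

Lemma measurable_upto (h : \bar R) :
  measurable ([set s | 0 <= s /\ (s%:E <= h)%E] : set (lebR R)).
Proof.
case: h => [h||].
- rewrite (_ : [set _ | _] = `[0, h]%classic); first exact: lebesgue_measurable_itv.
  apply/seteqP; split => s /=; rewrite in_itv/= lee_fin; first by case=> -> ->.
  by move=> /andP.
- rewrite (_ : [set _ | _] = `[0, +oo[%classic); first exact: lebesgue_measurable_itv.
  by apply/seteqP; split => s /=; rewrite in_itv/= andbT leey// => -[].
- rewrite (_ : [set _ | _] = set0); first exact: measurable0.
  by apply/seteqP; split => s //= [].
Qed.

Lemma integral_concat_le tau (h : \bar R) (u v : R -> R) : 0 <= tau -> (0 <= h)%E ->
  measurable_fun (`[0, +oo[ : set (lebR R)) (concat tau u v) ->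
  measurable_fun (`[0, +oo[ : set (lebR R)) v ->
  (forall s, 0 <= s -> 0 <= u s) -> (forall s, 0 <= s -> 0 <= v s) ->
  (\int[leb]_(s in [set s : R | (0 <= s)%R /\ s%:E <= tau%:E + h]) (concat tau u v s)%:E <=
   \int[leb]_(s in `[0%R, tau]) (u s)%:E +
   \int[leb]_(s in [set s : R | (0 <= s)%R /\ s%:E <= h]) (v s)%:E)%E.
Proof.
move=> tau0 h0 mw mv u0 v0.
(* The junction [tau] already belongs to the first piece, so time 0 is removed from the second to
   make the pieces disjoint. Putting it back at the end can only increase the integral. *)
pose D0 : set (lebR R) := [set s | 0 <= s /\ (s%:E <= h)%E] `&` `]0, +oo[.
have mD0 : measurable D0.
  by apply: measurableI; [exact: measurable_upto|exact: lebesgue_measurable_itv].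
have mD1 : measurable ((fun s : lebR R => s - tau : lebR R) @^-1` D0).
  exact: lebesgue_measurable_shift.
have mtau : measurable (`[0, tau]%classic : set (lebR R)) by exact: lebesgue_measurable_itv.
have E : [set s : R | (0 <= s)%R /\ (s%:E <= tau%:E + h)%E] =
    `[0, tau]%classic `|` (fun s => s - tau) @^-1` D0.
  apply/seteqP; split => s /=; rewrite /D0/= !in_itv/= !andbT.
    move=> [s0 sh]; have [st|ts] := leP s tau; [left|right]; rewrite ?s0//.
    by rewrite subr_ge0 subr_gt0 ltW// EFinB leeBlDl.
  move=> [/andP[s0 st]|[[st sh] ts]].
    split => //; apply: le_trans (_ : tau%:E <= _)%E; first by rewrite lee_fin.
    by rewrite leeDl.
  split; first by rewrite (le_trans tau0)// -subr_ge0.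
  by move: sh; rewrite EFinB leeBlDl.
have E0 : `[0, tau]%classic `|` (fun s => s - tau) @^-1` D0 `<=` `[0, +oo[%classic.
  by rewrite -E => s [s0 _]; rewrite /= in_itv/= s0.
rewrite E.
have w0 s : (`[0, tau]%classic `|` (fun s => s - tau) @^-1` D0) s ->
    (0 <= (concat tau u v s)%:E)%E.
  move=> /E0/=; rewrite in_itv/= andbT => s0; rewrite lee_fin /concat.
  by case: ifPn => [_|]; [exact: u0|rewrite -ltNge => ts; apply: v0; rewrite subr_ge0 ltW].
have m0oo : measurable (`[0, +oo[%classic : set (lebR R)) by exact: lebesgue_measurable_itv.
have mw' := measurable_funS m0oo E0 mw.
have dis : [disjoint `[0, tau]%classic & (fun s => s - tau) @^-1` D0].
  rewrite disj_set2E; apply/eqP/seteqP; split => // s [] /=.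
  by rewrite /D0/= !in_itv/= andbT subr_gt0 => /andP[_ +] [_]; rewrite leNgt => /negbTE ->.
have /measurable_EFinP mw'' := mw'.
rewrite (ge0_integral_setU _ mtau mD1 mw'' w0 dis).
apply: leeD.
  rewrite le_eqVlt; apply/orP; left; apply/eqP.
  apply: eq_integral => s; rewrite inE/= in_itv/= => /andP[_ st].
  by rewrite concat_le.
have mv0 : measurable_fun D0 (EFin \o v).
  apply/measurable_EFinP; apply: measurable_funS mv => // s [] [s0 _] _.
  by rewrite /= in_itv/= s0.
have v0' : {in D0, forall s, 0 <= (EFin \o v) s}%E.
  by move=> s; rewrite inE => -[] [s0 _] _; rewrite lee_fin v0.
have mh := measurable_upto h.
apply: (@le_trans _ _ (\int[leb]_(s in D0) (v s)%:E)%E).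
  rewrite (ge0_integral_shift (- tau) mD0 mv0 v0').
  rewrite le_eqVlt; apply/orP; left; apply/eqP.
  apply: eq_integral => s; rewrite inE/= => -[_]; rewrite /= in_itv/= andbT => st.
  by rewrite concat_gt// -subr_gt0.
apply: (ge0_subset_integral _ mD0 mh); last by move=> s [].
  apply/measurable_EFinP; apply: measurable_funS mv => // s [s0 _].
  by rewrite /= in_itv/= s0.
by move=> s [s0 _]; rewrite lee_fin v0.
Qed.

End Concat.

(** * Hitting times and admissibility *)

Section LeftLimit.
Context {R : realType}.

(** A nonnegative function has lower limit 0 exactly when arbitrarily small values recur arbitrarily
    late before [t]. This turns admissibility into a statement about single times, for finite and
    infinite [t] alike. *)
Lemma limf_einf_left_eq0 (g : R -> \bar R) (t : \bar R) :
  (forall s, 0 <= g s)%E -> (0 <= t)%E ->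
  limf_einf g (left_nbhs t) = 0%E <->
  forall e r : R, 0 < e -> (r%:E < t)%E ->
    exists s, [/\ r < s, (s%:E < t)%E & (g s < e%:E)%E].
Proof.
move=> g0 t0; rewrite limf_einfE; split => [sup0 e r e0 rt|H].
  pose V := [set s : R | r < s /\ (s%:E < t)%E].
  have : (ereal_inf (g @` V) < e%:E)%E.
    apply: (@le_lt_trans _ _ 0%E); last by rewrite lte_fin.
    by rewrite -sup0; apply: ereal_sup_ubound; exists V => //; exists r.
  by move=> /ereal_inf_lt[_ [s [rs st] <-] gs]; exists s.
apply/eqP; rewrite eq_le; apply/andP; split.
  apply: ge_ereal_sup => _ [V [r /= rt rV] <-].
  apply/lee_addgt0Pr => e e0; rewrite add0e.
  have [s [rs st gs]] := H e r e0 rt.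
  apply: le_trans (ltW gs); apply: ereal_inf_lbound; exists s => //.
  exact: rV.
apply: (@le_trans _ _ (ereal_inf (g @` setT))).
  by apply: le_ereal_inf_tmp => _ [s _ <-].
(* The whole line belongs to the left filter as soon as some real lies below [t]; [-1] does because
   [0 <= t]. *)
apply: ereal_sup_ubound; exists setT => //; exists (-1) => //=.
by apply: lt_le_trans t0; rewrite lte_fin ltrN10.
Qed.

End LeftLimit.

Section SetDistance.
Context {R : realType} {n : nat}.
Implicit Types (T : set 'rV[R]_n) (x z : 'rV[R]_n).

Lemma edist_set_ge0 T x : (0 <= edist_set T x)%E.
Proof. by apply: le_ereal_inf_tmp => _ [z _ <-]; rewrite lee_fin enorm_ge0. Qed.

Lemma edist_set_le T x z : T z -> (edist_set T x <= (enorm (x - z))%:E)%E.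
Proof. by move=> Tz; apply: ereal_inf_lbound; exists z. Qed.

Lemma edist_set_lt T x (e : R) : (edist_set T x < e%:E)%E ->
  exists2 z, T z & enorm (x - z) < e.
Proof. by move=> /ereal_inf_lt[_ [z Tz <-]]; rewrite lte_fin => ?; exists z. Qed.

Lemma notin_closed_enorm T x : closed T -> ~ T x ->
  exists2 e : R, 0 < e & forall z, enorm (z - x) < e -> ~ T z.
Proof.
move=> cT Tx; have : nbhs x (~` T) by apply: open_nbhs_nbhs; split => //; exact: closed_openC.
move=> /nbhs_normP[e /= e0 eT]; exists e => // z zx.
by apply: eT; rewrite /= distrC (le_lt_trans (norm_le_enorm _)).
Qed.

End SetDistance.

Section TrajectoryFacts.
Context {R : realType} {n m : nat}.
Variables (A : set 'rV[R]_m) (T : set 'rV[R]_n) (f : 'rV[R]_n * 'rV[R]_m -> 'rV[R]_n).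
Hypothesis T_closed : closed T.
Implicit Types (x : 'rV[R]_n) (y : R -> 'rV[R]_n) (alpha beta : R -> 'rV[R]_m).

(** The second case is the default of [xget]. Continuity and the initial value hold in both cases,
    so they follow without an existence theorem. *)
Lemma trajectory_dichotomy x alpha :
  is_trajectory f x alpha (trajectory f x alpha) \/ trajectory f x alpha = cst x.
Proof.
have [[y fy]|ny] := pselect (exists y, is_trajectory f x alpha y).
  by left; exact: (xgetPex (cst x) (ex_intro _ y fy)).
by right; apply: xgetPN => y fy; apply: ny; exists y.
Qed.

Lemma trajectory_continuous x alpha :
  {within `[0, +oo[, continuous (trajectory f x alpha)}.
Proof.
have [[]//|->] := trajectory_dichotomy x alpha.
by apply: continuous_subspaceT => z; exact: cvg_cst.
Qed.

Lemma trajectory0 x alpha : trajectory f x alpha 0 = x.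
Proof.
have [tr|->//] := trajectory_dichotomy x alpha.
apply/rowP => i.
by rewrite (is_trajectory_coord i tr)// set_itv1 Rintegral_set1 addr0.
Qed.

Lemma trajectory_near x alpha (h e : R) : 0 <= h -> 0 < e -> exists2 d, 0 < d &
  forall s, 0 <= s -> `|h - s| < d ->
    enorm (trajectory f x alpha s - trajectory f x alpha h) < e.
Proof.
move=> h0 e0; have ne0 : 0 < e / n.+1%:R by rewrite divr_gt0.
have := @trajectory_continuous x alpha.
move=> /subspace_continuousP/(_ h); rewrite /= in_itv/= andbT => /(_ h0).
move=> /cvgrPdist_lt/(_ _ ne0); rewrite near_withinE => /nbhs_normP[d /= d0 dP].
exists d => // s s0 hs; have := dP s hs; rewrite in_itv/= andbT => /(_ s0).
rewrite ltr_pdivlMr// distrC mulrC => H; apply: le_lt_trans H.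
by apply: le_trans (enorm_le_norm _) _; rewrite ler_wpM2r// ler_nat.
Qed.

Lemma hit_time_ge0 x alpha : (0 <= hit_time T f x alpha)%E.
Proof. by apply: le_ereal_inf_tmp => _ [t [t0 _] <-]; rewrite lee_fin. Qed.

Lemma hit_time_le x alpha (t : R) : 0 <= t -> T (trajectory f x alpha t) ->
  (hit_time T f x alpha <= t%:E)%E.
Proof. by move=> t0 Tt; apply: ereal_inf_lbound; exists t. Qed.

(** If the path were outside the closed target at time [h], it would remain outside for some further
    time [d], and the infimum would be at least [h + d]. *)
Lemma hit_time_attained x alpha (h : R) : hit_time T f x alpha = h%:E ->
  0 <= h /\ T (trajectory f x alpha h).
Proof.
move=> hE; have h0 : 0 <= h by rewrite -lee_fin -hE hit_time_ge0.
split => //; apply: contrapT => nT.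
have [e e0 eT] := notin_closed_enorm T_closed nT.
have [d d0 dT] := trajectory_near x alpha h0 e0.
suff : ((h + d)%:E <= hit_time T f x alpha)%E by rewrite hE lee_fin gerDl leNgt d0.
apply: le_ereal_inf_tmp => _ [t [t0 Tt] <-]; rewrite lee_fin leNgt; apply/negP => td.
have ht : h <= t by rewrite -lee_fin -hE hit_time_le.
apply: (eT (trajectory f x alpha t)) Tt; apply: dT => //.
by rewrite distrC ger0_norm ?subr_ge0// ltrBlDl.
Qed.

Lemma hit_time_gt0 x alpha : ~ T x -> (0 < hit_time T f x alpha)%E.
Proof.
move=> Tx; rewrite lt_neqAle hit_time_ge0 andbT; apply/eqP => /esym/hit_time_attained[_].
by rewrite trajectory0.
Qed.

(** The path is continuous and lies in the target at its hitting time, so the distance tends to 0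
    there; starting off the target makes that time positive. *)
Lemma adm_fin_adm x alpha : ~ T x -> adm_fin A T f x alpha -> adm A T f x alpha.
Proof.
move=> Tx [ca hfin]; split => //.
apply/(limf_einf_left_eq0 (fun s => edist_set_ge0 _ _) (hit_time_ge0 _ _)) => e r e0.
have hp := hit_time_gt0 alpha Tx.
have [h hE] : exists h, hit_time T f x alpha = h%:E.
  exists (fine (hit_time T f x alpha)); rewrite fineK// ge0_fin_numE//.
  exact: hit_time_ge0.
rewrite hE !lte_fin in hp *; move=> rh.
have [h0 Th] := hit_time_attained hE.
have [d d0 dT] := trajectory_near x alpha h0 e0.
pose b := Num.max (Num.max r 0) (h - d).
have bh : b < h by rewrite !gt_max rh hp gtrBl d0.
have [rb b0 db] : [/\ r <= b, 0 <= b & h - d <= b].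
  by rewrite !le_max !lexx !orbT.
(* The midpoint lies after [r], is nonnegative and is within [d] of [h], since [b] dominates [r],
   [0] and [h - d]. *)
exists ((b + h) / 2); split; [by lra|by rewrite lte_fin; lra|].
apply: le_lt_trans (edist_set_le _ Th) _; rewrite lte_fin; apply: dT; first by lra.
by rewrite ger0_norm; lra.
Qed.

(* With no trajectory at all, the default path stays at positive distance from the target. *)
Lemma adm_is_trajectory x alpha : ~ T x -> adm A T f x alpha ->
  is_trajectory f x alpha (trajectory f x alpha).
Proof.
move=> Tx [_ /(limf_einf_left_eq0 (fun s => edist_set_ge0 _ _) (hit_time_ge0 _ _)) lim0].
have [//|E] := trajectory_dichotomy x alpha.
have [e e0 eT] := notin_closed_enorm T_closed Tx.
have [|s [_ _ /edist_set_lt[z Tz]]] := lim0 e (-1) e0.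
  by apply: lt_le_trans (hit_time_ge0 _ _); rewrite lte_fin ltrN10.
by rewrite E/= enorm_distC => xz; have := eT z xz.
Qed.

End TrajectoryFacts.

(** * Trajectories, hitting times and costs of spliced controls *)

Section ConcatTrajectories.
Context {R : realType} {n m : nat}.
Variables (A : set 'rV[R]_m) (T : set 'rV[R]_n) (f : 'rV[R]_n * 'rV[R]_m -> 'rV[R]_n).
Hypothesis A_compact : compact A.
Hypothesis T_closed : closed T.
Hypothesis f_cont : {within [set z | A z.2], continuous f}.
Hypothesis f_lip : forall r : R, 0 < r -> exists2 L : R, 0 < L &
  forall x1 x2 a, enorm x1 <= r -> enorm x2 <= r -> A a ->
    enorm (f (x1, a) - f (x2, a)) <= L * enorm (x1 - x2).
Implicit Types (x : 'rV[R]_n) (y : R -> 'rV[R]_n) (alpha beta : R -> 'rV[R]_m).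
Implicit Types (rho : 'rV[R]_n * 'rV[R]_m -> R).

(** Past [tau] the integral splits: the head brings the path to [y1 tau], and the tail, translated
    by [tau], is the integral equation of [y2]. *)
Lemma is_trajectory_concat x alpha beta y1 y2 (tau : R) : 0 <= tau ->
  controls A alpha -> controls A beta ->
  is_trajectory f x alpha y1 -> is_trajectory f (y1 tau) beta y2 -> y2 0 = y1 tau ->
  is_trajectory f x (concat tau alpha beta) (concat tau y1 y2).
Proof.
move=> tau0 ca cb tr1 tr2 y20; have [cy1 _] := tr1; have [cy2 _] := tr2.
have cy : {within `[0, +oo[, continuous (concat tau y1 y2)} by exact: concat_continuous.
have cc := controls_concat tau0 ca cb.
have head i (t : R) : t <= tau ->
    Rintegral leb `[0, t] (fun s => f (concat tau y1 y2 s, concat tau alpha beta s) ord0 i) =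
    Rintegral leb `[0, t] (fun s => f (y1 s, alpha s) ord0 i).
  move=> tt; apply: eq_Rintegral => s; rewrite inE/= in_itv/= => /andP[_ st].
  by rewrite !concat_le// (le_trans st).
split => // t t0; apply/rowP => i; rewrite !mxE.
have [tt|tt] := leP t tau; first by rewrite concat_le// head// (is_trajectory_coord i tr1).
rewrite concat_gt// (is_trajectory_coord i tr2) ?subr_ge0 ?(ltW tt)//.
rewrite (is_trajectory_coord i tr1)// -addrA; congr (_ + _).
have ig := integrable_running A_compact t cc cy (@coord_f_cont _ _ _ _ _ f_cont i).
rewrite (Rintegral_split tau0 (ltW tt) ig) head//; congr (_ + _).
have ig2 := integrable_running A_compact (t - tau) cb cy2 (@coord_f_cont _ _ _ _ _ f_cont i).
have ttau : 0 <= t - tau by rewrite subr_ge0 ltW.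
(* Dropping the null endpoint makes the translated domain exactly []tau, t]], the tail of the
   split. *)
rewrite -(Rintegral_open_left ttau ig2).
have mD : measurable (`]0, t - tau]%classic : set (lebR R)) by exact: lebesgue_measurable_itv.
rewrite (Rintegral_shift (- tau) mD); last first.
  apply: (measurable_running_itv cb cy2 (@coord_f_cont _ _ _ _ _ f_cont i)).
  by move=> s; rewrite /= !in_itv/= andbT => /andP[/ltW].
rewrite (_ : _ @^-1` _ = `]tau, t]%classic); last first.
  by apply/seteqP; split => s /=; rewrite !in_itv/= subr_gt0 lerBlDr subrK.
apply: eq_Rintegral => s; rewrite inE/= in_itv/= => /andP[ts _].
by rewrite !concat_gt.
Qed.

Lemma trajectoryE x alpha y (t : R) : controls A alpha -> is_trajectory f x alpha y ->
  0 <= t -> trajectory f x alpha t = y t.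
Proof.
move=> ca tr; apply: (is_trajectory_unique A_compact f_cont f_lip ca _ tr).
exact: (xgetPex (cst x) (ex_intro _ y tr)).
Qed.

Section Switch.
Variables (x : 'rV[R]_n) (alpha beta : R -> 'rV[R]_m) (tau : R).
Let z := trajectory f x alpha tau.
Let gamma := concat tau alpha beta.
Hypothesis tau0 : 0 <= tau.
Hypothesis alpha_control : controls A alpha.
Hypothesis beta_control : controls A beta.
Hypothesis alpha_traj : is_trajectory f x alpha (trajectory f x alpha).
Hypothesis beta_traj : is_trajectory f z beta (trajectory f z beta).
Hypothesis alpha_hit : hit_time T f x alpha = +oo%E.

Lemma trajectory_concat s : 0 <= s ->
  trajectory f x gamma s = concat tau (trajectory f x alpha) (trajectory f z beta) s.
Proof.
apply: trajectoryE; first exact: controls_concat.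
by apply: is_trajectory_concat => //; exact: trajectory0.
Qed.

Lemma trajectory_concat_shift s : 0 <= s ->
  trajectory f x gamma (tau + s) = trajectory f z beta s.
Proof.
move=> s0; rewrite trajectory_concat ?addr_ge0//.
have := s0; rewrite le_eqVlt => /predU1P[<-|s0'].
  by rewrite addr0 concat_le// trajectory0.
by rewrite concat_gt ?ltrDl// addrC addKr.
Qed.

Lemma notin_target s : 0 <= s -> ~ T (trajectory f x alpha s).
Proof. by move=> s0 /(hit_time_le s0); rewrite alpha_hit leye_eq. Qed.

(** The path of [alpha] never hits the target, so the hits of the spliced path are those of the
    second path delayed by [tau]. *)
Lemma hit_time_concat : hit_time T f x gamma = (tau%:E + hit_time T f z beta)%E.
Proof.
apply/eqP; rewrite eq_le; apply/andP; split; last first.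
  apply: le_ereal_inf_tmp => _ [t [t0]] + <-; rewrite trajectory_concat//.
  have [tt|tt] := leP t tau; first by rewrite concat_le// => /(notin_target t0).
  rewrite concat_gt// -leeBrDl// -EFinB; apply: hit_time_le.
  by rewrite subr_ge0 ltW.
rewrite -leeBlDl//; apply: le_ereal_inf_tmp => _ [t [t0 Tt] <-].
rewrite leeBlDl// -EFinD; apply: hit_time_le; first exact: addr_ge0.
by rewrite trajectory_concat_shift.
Qed.

Lemma adm_concat : adm A T f z beta -> adm A T f x gamma.
Proof.
move=> [cb /(limf_einf_left_eq0 (fun s => edist_set_ge0 _ _) (hit_time_ge0 _ _ _ _)) lim0].
split; first exact: controls_concat.
apply/(limf_einf_left_eq0 (fun s => edist_set_ge0 _ _) (hit_time_ge0 _ _ _ _)) => e r e0.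
rewrite hit_time_concat => rh.
have hz : (0 < hit_time T f z beta)%E by apply: hit_time_gt0 => //; exact: notin_target.
have [|s [rs sh es]] := lim0 e (Num.max (r - tau) 0) e0.
  by rewrite EFin_max gt_max hz andbT EFinB lteBlDl.
move: rs; rewrite gt_max => /andP[rs s0].
exists (tau + s); split; first by rewrite addrC -ltrBlDr.
  by rewrite EFinD lteD2lE.
by rewrite trajectory_concat_shift// ltW.
Qed.

(** Stated for any running cost: with [l] it bounds the cost of the spliced control, with [rho] it
    keeps that control in [adm_rho]. *)
Lemma cost_concat rho : continuous_nonneg A rho ->
  (cost f rho (hit_time T f x gamma) x gamma <=
   \int[@completed_lebesgue_measure R]_(s in `[0%R, tau])
     (rho (trajectory f x alpha s, alpha s))%:E +
   cost f rho (hit_time T f z beta) z beta)%E.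
Proof.
move=> [crho rho0].
pose u s := rho (trajectory f x alpha s, alpha s).
pose v s := rho (trajectory f z beta s, beta s).
have cc := controls_concat tau0 alpha_control beta_control.
have E s : 0 <= s -> rho (trajectory f x gamma s, gamma s) = concat tau u v s.
  by move=> s0; rewrite trajectory_concat// /u /v /gamma /concat; case: ifP.
have mw : measurable_fun (`[0, +oo[ : set (lebR R)) (concat tau u v).
  apply: eq_measurable_fun (measurable_running cc
    (@trajectory_continuous _ _ _ f x gamma) crho).
  by move=> s; rewrite inE/= in_itv/= andbT; exact: E.
have mv : measurable_fun (`[0, +oo[ : set (lebR R)) v.
  exact: measurable_running beta_control
    (@trajectory_continuous _ _ _ f z beta) crho.
have u0 s : 0 <= s -> 0 <= u s by move=> s0; apply: rho0; exact: alpha_control.1.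
have v0 s : 0 <= s -> 0 <= v s by move=> s0; apply: rho0; exact: beta_control.1.
apply: le_trans (integral_concat_le tau0 (hit_time_ge0 T f z beta) mw mv u0 v0).
rewrite le_eqVlt; apply/orP; left; apply/eqP; rewrite /cost hit_time_concat.
by apply: eq_integral => s; rewrite inE/= => -[s0 _]; rewrite E.
Qed.

End Switch.

Lemma cost_lt_pinfty rho x alpha (t : R) : controls A alpha -> continuous_nonneg A rho ->
  (\int[@completed_lebesgue_measure R]_(s in `[0%R, t])
     (rho (trajectory f x alpha s, alpha s))%:E < +oo)%E.
Proof.
move=> ca [crho rho0].
have /integrableP[_] := integrable_running A_compact t ca
  (@trajectory_continuous _ _ _ f x alpha) crho.
apply: le_lt_trans; rewrite le_eqVlt; apply/orP; left; apply/eqP.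
apply: eq_integral => s; rewrite inE/= in_itv/= => /andP[s0 _].
by rewrite ger0_norm//; apply: rho0; exact: ca.1.
Qed.

End ConcatTrajectories.

(** * Value functions *)

Section Boundary.
Context {R : realType} {n : nat}.
Variable T : set 'rV[R]_n.
Hypothesis T_closed : closed T.

(** If the segment from [x] to [z] avoided the boundary, its part in [T] would be closed, open and
    nonempty in the connected segment, hence would contain [x]. *)
Lemma bdry_between (x z : 'rV[R]_n) : ~ T x -> T z ->
  exists2 w, bdry T w & `|x - w| <= `|x - z|.
Proof.
move=> Tx Tz; pose p (s : R) := x + s *: (z - x).
have cp : continuous p.
  by move=> s; apply: cvgD; [exact: cvg_cst|apply: cvgZr_tmp; exact: cvg_id].
apply: contrapT => nb.
have nbp s : 0 <= s <= 1 -> ~ bdry T (p s).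
  move=> /andP[s0 s1] bs; apply: nb; exists (p s) => //.
  rewrite /p opprD addrA subrr add0r normrN normrZ distrC ger0_norm//.
  by rewrite ler_piMl.
have conn : connected (p @` `[0, 1]).
  apply: connected_continuous_connected; first exact: segment_connected.
  exact: continuous_subspaceT.
have : (p @` `[0, 1]) `&` T = p @` `[0, 1].
  apply: conn.
  - exists z; split => //; exists 1; first by rewrite /= in_itv/= ler01 lexx.
    by rewrite /p scale1r addrC subrK.
  - exists (interior T); first exact: open_interior.
    apply/seteqP; split => w [pw Tw]; split => //; last exact: interior_subset.
    apply: contrapT => nw; case: pw => s; rewrite /= in_itv/= => /nbp + E.
    by rewrite E; apply; split => //; exact: subset_closure.
  - by exists T.
move=> /seteqP[_ /(_ x)][|//]; exists 0; first by rewrite /= in_itv/= lexx ler01.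
by rewrite /p scale0r addr0.
Qed.

(** Compactness of the boundary, in its near-covering form, makes the radius of continuity uniform.
    An outside point close to [T] is at least as close to the boundary in the sup norm, by
    [bdry_between]. *)
Lemma small_near_target (W : 'rV[R]_n -> \bar R) (e : R) : compact (bdry T) ->
  continuous_on_bdry T W -> (forall x, T x -> W x = 0%E) -> 0 < e ->
  exists2 d : R, 0 < d &
    forall x, ~ T x -> (edist_set T x < d%:E)%E -> (W x < e%:E)%E.
Proof.
move=> /compact_near_coveringP cov cW W0 e0.
have near_d : \forall d \near 0^'+, bdry T `<=`
    [set w | forall x, `|x - w| < d -> ~ T x -> (W x < e%:E)%E].
  apply: (cov R (0^'+) (fun d w => forall x, `|x - w| < d -> ~ T x -> (W x < e%:E)%E)) => w bw.
  have Ww0 : W w = 0%E by apply: W0; rewrite ((closure_id T).1 T_closed); exact: bw.1.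
  have : nbhs w [set x | ~ T x -> (W x < e%:E)%E].
    have := cW w bw [set y | (y < e%:E)%E].
    rewrite Ww0 => H.
    have He : nbhs (0%E : \bar R) [set y | (y < e%:E)%E].
      by apply: open_nbhs_nbhs; split; [exact: open_ereal_lt_ereal|rewrite /= lte_fin].
    have Hw : nbhs w [set x | ~ interior T x -> (W x < e%:E)%E] := H He.
    by apply: filterS Hw => x + Tx; apply => /interior_subset.
  move=> /nbhs_normP[r /= r0 rW].
  (* Half of [r] pays for moving from [w] to a nearby [w'], the other half for the distance to
     [x]. *)
  exists (ball w (r / 2), [set d | d < r / 2]) => /=.
    by split; [apply: nbhsx_ballx|apply: nbhs_right_lt]; exact: divr_gt0.
  move=> [w' d] [/= ww' dr] x xw; apply: rW => /=; rewrite -ball_normE/= in ww'.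
  rewrite (splitr r) -(subrK w' w) -addrA; apply: le_lt_trans (ler_normD _ _) _.
  by rewrite ltrD// distrC (lt_trans xw).
have [d [dP /= d0]] := filter_ex (filterI near_d (nbhs_right_gt (0 : R))).
exists d => // x Tx /edist_set_lt[z Tz xz].
have [w bw wz] := bdry_between Tx Tz.
apply: (dP w bw) Tx; apply: le_lt_trans wz _; apply: le_lt_trans xz.
exact: norm_le_enorm.
Qed.

End Boundary.

(** * Comparison of infima over different classes of controls *)

Section ValueOver.
Context {R : realType} {n m : nat}.
Variables (A : set 'rV[R]_m) (T : set 'rV[R]_n) (f : 'rV[R]_n * 'rV[R]_m -> 'rV[R]_n).
Variable (l : 'rV[R]_n * 'rV[R]_m -> R).
Hypothesis A_compact : compact A.
Hypothesis T_closed : closed T.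
Hypothesis T_bdry_compact : compact (bdry T).
Hypothesis f_cont : {within [set z | A z.2], continuous f}.
Hypothesis f_lip : forall r : R, 0 < r -> exists2 L : R, 0 < L &
  forall x1 x2 a, enorm x1 <= r -> enorm x2 <= r -> A a ->
    enorm (f (x1, a) - f (x2, a)) <= L * enorm (x1 - x2).
Hypothesis l_cont : continuous_nonneg A l.
Implicit Types (x : 'rV[R]_n) (alpha beta : R -> 'rV[R]_m).
Implicit Types (S : 'rV[R]_n -> set (R -> 'rV[R]_m)).

Lemma value_over_in S x : T x -> value_over T f S l x = 0%E.
Proof. by move=> Tx; rewrite /value_over mem_set. Qed.

Lemma value_over_out S x : ~ T x -> value_over T f S l x =
  ereal_inf [set cost f l (hit_time T f x alpha) x alpha | alpha in S x].
Proof. by move=> Tx; rewrite /value_over memNset. Qed.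

Lemma value_over_le S S' x : (~ T x -> S x `<=` S' x) ->
  (value_over T f S' l x <= value_over T f S l x)%E.
Proof.
move=> SS'; have [Tx|Tx] := pselect (T x); first by rewrite !value_over_in.
by rewrite !value_over_out//; apply/ereal_inf_le_tmp/image_subset/SS'.
Qed.

Lemma adm_fin_adm_rho rho x : continuous_nonneg A rho -> ~ T x ->
  adm_fin A T f x `<=` adm_rho A T f rho x.
Proof.
move=> crho Tx alpha aa; split; first exact: adm_fin_adm.
have [ca hfin] := aa.
have [h hE] : exists h, hit_time T f x alpha = h%:E.
  exists (fine (hit_time T f x alpha)); rewrite fineK// ge0_fin_numE//.
  exact: hit_time_ge0.
rewrite hE; apply: le_lt_trans (cost_lt_pinfty f A_compact x h ca crho).
rewrite le_eqVlt; apply/orP; left; apply/eqP; congr (integral _ _ _).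
by apply/seteqP; split => s /=; rewrite in_itv/= lee_fin => /andP.
Qed.

(* A control whose path approaches the target without hitting it is followed until the path is
   so close to the target that the remaining optimal cost is at most [e], and then replaced by
   an [e]-optimal member of [S]. *)
Lemma value_over_eq S :
  (forall x, ~ T x -> S x `<=` adm A T f x) ->
  (forall x, ~ T x -> adm_fin A T f x `<=` S x) ->
  (forall x alpha beta tau, ~ T x -> 0 <= tau -> adm A T f x alpha ->
    hit_time T f x alpha = +oo%E -> S (trajectory f x alpha tau) beta ->
    S x (concat tau alpha beta)) ->
  continuous_on_bdry T (value_over T f S l) ->
  forall x, value_over T f S l x = value A T f l x.
Proof.
move=> Sadm finS Sconcat cW x; apply/eqP; rewrite eq_le; apply/andP; split; last first.
  by apply: value_over_le; exact: Sadm.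
have [Tx|Tx] := pselect (T x); first by rewrite /value !value_over_in.
rewrite [leRHS]value_over_out//; apply: le_ereal_inf_tmp => _ [alpha aa <-].
have [ca lim0] := aa.
(* With a finite hitting time, [alpha] itself competes in [S]. *)
have [hfin|] := ltP (hit_time T f x alpha) +oo%E.
  rewrite value_over_out//; apply: ereal_inf_lbound; exists alpha => //.
  exact: finS.
rewrite leye_eq => /eqP hoo.
apply/lee_addgt0Pr => e e0.
have [d d0 dP] := small_near_target T_closed T_bdry_compact cW (@value_over_in S) e0.
move/(limf_einf_left_eq0 (fun s => edist_set_ge0 _ _) (hit_time_ge0 _ _ _ _)) : lim0.
(* The small distances that recur along the path supply the switching time [tau]; the lower bound
   [0] makes it positive. *)
rewrite hoo => /(_ d 0 d0 (ltry _))[tau [tau0 _ taud]].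
have nT := notin_target hoo (ltW tau0).
have := dP _ nT taud; rewrite value_over_out// => /ereal_inf_lt[_ [beta Sb <-] cb].
have ab := Sadm _ nT _ Sb.
rewrite value_over_out//; apply: (@le_trans _ _
  (cost f l (hit_time T f x (concat tau alpha beta)) x (concat tau alpha beta))).
  apply: ereal_inf_lbound; exists (concat tau alpha beta) => //.
  by apply: Sconcat => //; exact: ltW.
have xtraj := adm_is_trajectory T_closed Tx aa.
have ztraj := adm_is_trajectory T_closed nT ab.
apply: le_trans (cost_concat A_compact f_cont f_lip (ltW tau0) ca ab.1
  xtraj ztraj hoo l_cont) _.
apply: leeD; last exact: ltW.
(* Since [l] is nonnegative, the cost of [alpha] up to [tau] is at most its total cost. *)
rewrite /cost; apply: ge0_subset_integral.
- exact: lebesgue_measurable_itv.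
- exact: measurable_upto.
- apply/measurable_EFinP; apply: (measurable_running_itv ca
    (@trajectory_continuous _ _ _ f x alpha) l_cont.1).
  by move=> s [s0 _]; rewrite /= in_itv/= s0.
- by move=> s [s0 _]; rewrite lee_fin; apply: l_cont.2; exact: ca.1.
- by move=> s; rewrite /= in_itv/= => /andP[s0 _]; rewrite leey.
Qed.

End ValueOver.

Theorem theorem3p2 (R : realType) (n m : nat)
    (A : set 'rV[R]_m) (T : set 'rV[R]_n)
    (f : 'rV[R]_n * 'rV[R]_m -> 'rV[R]_n) (l : 'rV[R]_n * 'rV[R]_m -> R)
    (A_compact : compact A)
    (T_closed : closed T) (T_bdry_compact : compact (bdry T))
    (f_cont : {within [set z : 'rV[R]_n * 'rV[R]_m | A z.2], continuous f})
    (l_cont_nonneg : continuous_nonneg A l)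
    (f_growth : exists2 M : R, 0 < M &
       forall x a, A a -> enorm (f (x, a)) <= M * (1 + enorm x))
    (fl_lip : forall r : R, 0 < r -> exists2 L : R, 0 < L &
       forall x1 x2 a, enorm x1 <= r -> enorm x2 <= r -> A a ->
         enorm (f (x1, a) - f (x2, a)) <= L * enorm (x1 - x2) /\
         `|l (x1, a) - l (x2, a)| <= L * enorm (x1 - x2)) :
  (forall x, ~ T x -> value A T f l x = value_fin A T f l x ->
     forall rho, continuous_nonneg A rho -> value_rho A T f rho l x = value A T f l x) /\
  (forall rho, continuous_nonneg A rho ->
     continuous_on_bdry T (value_rho A T f rho l) ->
     forall x, value_rho A T f rho l x = value A T f l x) /\
  (continuous_on_bdry T (value_fin A T f l) ->
     forall rho, continuous_nonneg A rho ->
     forall x, value_fin A T f l x = value_rho A T f rho l x /\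
               value_rho A T f rho l x = value A T f l x).
Proof.
have f_lip r : 0 < r -> exists2 L : R, 0 < L &
    forall x1 x2 a, enorm x1 <= r -> enorm x2 <= r -> A a ->
      enorm (f (x1, a) - f (x2, a)) <= L * enorm (x1 - x2).
  move=> /fl_lip[L L0 fL]; exists L => // x1 x2 a x1r x2r Aa.
  by have [] := fL x1 x2 a x1r x2r Aa.
(* Off the target [adm_fin] lies in [adm_rho], which lies in [adm], so [value_rho] is between
   [value] and [value_fin]. *)
have squeeze rho x : continuous_nonneg A rho ->
    value A T f l x = value_fin A T f l x -> value_rho A T f rho l x = value A T f l x.
  move=> crho E; apply/eqP; rewrite eq_le; apply/andP; split.
    by rewrite E; apply: value_over_le => Tx; exact: adm_fin_adm_rho.
  by apply: value_over_le => _ alpha [].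
split; first by move=> x _ E rho crho; exact: squeeze.
split.
  move=> rho crho; apply: (value_over_eq A_compact T_closed T_bdry_compact f_cont
    f_lip l_cont_nonneg).
  - by move=> x _ alpha [].
  - by move=> x; exact: adm_fin_adm_rho.
  move=> x alpha beta tau Tx tau0 aa hoo [ab cb].
  have ztraj := adm_is_trajectory T_closed (notin_target hoo tau0) ab.
  have xtraj := adm_is_trajectory T_closed Tx aa.
  split; first by apply: (adm_concat A_compact) => //; [exact: aa.1|exact: ab.1].
  (* Splicing preserves [adm_rho]: the integral of [rho] is finite up to [tau], and [beta] adds a
     finite amount. *)
  apply: le_lt_trans (cost_concat A_compact f_cont f_lip tau0 aa.1 ab.1
    xtraj ztraj hoo crho) _.
  by rewrite lte_add_pinfty// (cost_lt_pinfty f A_compact _ _ aa.1 crho).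
move=> cfin rho crho x.
(* The same comparison with [S] equal to [adm_fin], which is stable under splicing because the new
   hitting time is [tau] plus a finite one. *)
have E y : value_fin A T f l y = value A T f l y.
  move: cfin y; apply: (value_over_eq A_compact T_closed T_bdry_compact f_cont
    f_lip l_cont_nonneg).
  - by move=> y Ty alpha; exact: (adm_fin_adm T_closed Ty).
  - by move=> y _ alpha.
  move=> y alpha beta tau Ty tau0 aa hoo [cb hb].
  have nT := notin_target hoo tau0.
  have ab : adm A T f (trajectory f y alpha tau) beta.
    exact: (adm_fin_adm T_closed nT).
  have ztraj := adm_is_trajectory T_closed nT ab.
  have ytraj := adm_is_trajectory T_closed Ty aa.
  split; first exact: controls_concat aa.1 cb.
  by rewrite (hit_time_concat A_compact f_cont f_lip tau0 aa.1 cb)// lte_add_pinfty// ltry.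
by rewrite E squeeze.
Qed.
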